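(* The sequence $(x_n^{(3)})$ satisfies $x_1^{(3)}=3$, $x_2^{(3)}=6$, and $x_{2n-1}^{(3)}=2x_{n-1}^{(3)}+1$ for all $n\geq2$, $x_{2n}^{(3)}=2x_n^{(3)}$ for all $n\geq1$.
   Context: For a positive integer $m$, let $\nu_2(m)$ be the exponent of the highest power of $2$ dividing $m$. Define $x_1^{(3)}=3$ and, for $n\ge2$, $x_n^{(3)}$ is the smallest integer $y>x_{n-1}^{(3)}$ with $\nu_2(y)=\nu_2(n)$. *)

(* Defs.v *)
From mathcomp Require Import all_boot.

Set Implicit Arguments.
Unset Strict Implicit.
Unset Printing Implicit Defensive.

Definition nu2 (m : nat) : nat := logn 2 m.

Lemma next_nu2_exists (n x : nat) : exists y, (x < y) && (nu2 y == nu2 n).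
Proof.
exists (2 ^ nu2 n * (x.*2).+1); apply/andP; split.
  apply: (@leq_trans (x.*2).+1); first by rewrite ltnS -addnn leq_addr.
  by rewrite leq_pmull // expn_gt0.
rewrite /nu2 lognM ?expn_gt0 // pfactorK //.
by rewrite [logn 2 _.+1]lognE dvdn2 /= odd_double addn0.
Qed.

Definition next_nu2 (n x : nat) : nat := ex_minn (next_nu2_exists n x).

(* [x3 n] is x_n^(3) for n >= 1; the value at 0 is a dummy. *)
Fixpoint x3 (n : nat) : nat :=
  match n with
  | 0 => 0
  | 1 => 3
  | (_.+1 as k).+1 => next_nu2 k.+1 (x3 k)
  end.

(* Main.v *)
Require Import Defs.
From mathcomp Require Import all_boot.

Set Implicit Arguments.
Unset Strict Implicit.
Unset Printing Implicit Defensive.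

(** For odd [n] the next term is simply the next larger odd number, while for
    even indices halving both index and position commutes with [next_nu2]. Hence
    if [x3 (2 * n) = 2 * x3 n], then [x3 (2 * n + 1) = 2 * x3 n + 1], whose half
    is again [x3 n], so that [x3 (2 * n + 2) = 2 * x3 (n + 1)]. *)

Lemma nu2_eq0 n : 0 < n -> (nu2 n == 0) = odd n.
Proof. by move=> n_gt0; rewrite /nu2 lognE n_gt0 dvdn2; case: (odd n). Qed.

Lemma nu2_double n : 0 < n -> nu2 n.*2 = (nu2 n).+1.
Proof. by move=> n_gt0; rewrite /nu2 -mul2n lognM. Qed.

Lemma eq_nu2_odd m n : 0 < m -> 0 < n -> nu2 m = nu2 n -> odd m = odd n.
Proof. by move=> m_gt0 n_gt0 eq_nu; rewrite -!nu2_eq0 ?eq_nu. Qed.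

Lemma ltn_next_nu2 n x : x < next_nu2 n x.
Proof. by rewrite /next_nu2; case: ex_minnP => y /andP[]. Qed.

Lemma nu2_next_nu2 n x : nu2 (next_nu2 n x) = nu2 n.
Proof. by rewrite /next_nu2; case: ex_minnP => y /andP[_ /eqP]. Qed.

Lemma next_nu2_min n x y : x < y -> nu2 y = nu2 n -> next_nu2 n x <= y.
Proof.
rewrite /next_nu2; case: ex_minnP => m _ min_m lt_xy nu_y.
by apply: min_m; rewrite lt_xy nu_y eqxx.
Qed.

Lemma next_nu2_unique n x y :
    x < y -> nu2 y = nu2 n -> (forall z, x < z -> nu2 z = nu2 n -> y <= z) ->
  next_nu2 n x = y.
Proof.
move=> lt_xy nu_y min_y; apply/eqP; rewrite eqn_leq next_nu2_min //=.
exact: min_y (ltn_next_nu2 n x) (nu2_next_nu2 n x).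
Qed.

Lemma next_nu2_odd n x : odd n -> next_nu2 n x = (uphalf x).*2.+1.
Proof.
move=> odd_n; have n_gt0 := odd_gt0 odd_n.
apply: next_nu2_unique => [||z lt_xz nu_z].
- by rewrite ltnS -leq_uphalf_double.
- have /eqP-> : nu2 (uphalf x).*2.+1 == 0 by rewrite nu2_eq0 //= odd_double.
  by apply/esym/eqP; rewrite nu2_eq0.
have odd_z : odd z by rewrite (eq_nu2_odd _ n_gt0 nu_z) // (leq_trans _ lt_xz).
move: lt_xz; rewrite -[z]odd_double_half odd_z add1n !ltnS leq_double.
by rewrite leq_uphalf_double.
Qed.

Lemma next_nu2_double n x : 0 < n -> next_nu2 n.*2 x = (next_nu2 n x./2).*2.
Proof.
move=> n_gt0; have lt_next := ltn_next_nu2 n x./2.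
apply: next_nu2_unique => [||z lt_xz nu_z].
- by rewrite -ltn_half_double.
- by rewrite !nu2_double ?nu2_next_nu2 // (leq_trans _ lt_next).
have z_gt0 : 0 < z by apply: leq_trans lt_xz.
have even_z : ~~ odd z.
  by rewrite (eq_nu2_odd z_gt0 _ nu_z) ?odd_double ?double_gt0.
rewrite -(even_halfK even_z) double_gt0 in z_gt0 lt_xz nu_z *.
rewrite leq_double next_nu2_min ?ltn_half_double //.
by move: nu_z; rewrite !nu2_double // => -[].
Qed.

Lemma x3S n : 0 < n -> x3 n.+1 = next_nu2 n.+1 (x3 n).
Proof. by case: n. Qed.

Lemma x3_doubleS n : 0 < n -> x3 n.*2.+1 = (uphalf (x3 n.*2)).*2.+1.
Proof.
by move=> n_gt0; rewrite x3S ?double_gt0 // next_nu2_odd //= odd_double.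
Qed.

Lemma x3_double n : 0 < n -> x3 n.*2 = (x3 n).*2.
Proof.
elim: n => // -[_ _|n IHn _].
  by rewrite -[LHS]/(next_nu2 1.*2 3) next_nu2_double // next_nu2_odd.
have half_x3 : (x3 n.+1.*2.+1)./2 = x3 n.+1.
  by rewrite x3_doubleS // IHn // uphalf_double /= uphalf_double.
by rewrite doubleS x3S // -doubleS next_nu2_double // half_x3 -x3S.
Qed.

Theorem theorem4 :
  [/\ x3 1 = 3,
      x3 2 = 6,
      (forall n : nat, 2 <= n -> x3 (2 * n - 1) = 2 * x3 (n - 1) + 1)
    & (forall n : nat, 1 <= n -> x3 (2 * n) = 2 * x3 n)].
Proof.
split=> [//||[|[|n]] // _|n n_gt0].
- exact: (@x3_double 1).
- rewrite !mul2n !subn1 addn1 doubleS !succnK.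
  by rewrite x3_doubleS // x3_double // uphalf_double.
- by rewrite !mul2n x3_double.
Qed.
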